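(* Let $\mathfrak{g}$ be a finite-dimensional complex simple Lie algebra with Cartan subalgebra $\mathfrak{h}$, root system $\Phi$, a choice of positive roots $\Phi^+$, and root vectors $E_\alpha$. Let $B=\mathfrak{h}\oplus\bigoplus_{\alpha\in\Phi^+}\mathbb{C}E_\alpha$ be the corresponding Borel subalgebra. Then for any basis of $B$, the spectral matrix $\lambda_B$ of $B$ satisfies $\mathrm{rank}\,\lambda_B=\dim\mathfrak{h}$.
   Context: Let $\mathfrak{L}$ be a solvable Lie algebra with ordered basis $(\upsilon_1,\dots,\upsilon_N)$ and let $f_{\mathfrak{L}}(z)=\det\big(z_0I+\sum_{i=1}^N z_i\,\mathrm{ad}\,\upsilon_i\big)$ be the characteristic polynomial of its adjoint representation. Since $\mathfrak{L}$ is solvable, $f_{\mathfrak{L}}$ factors as $f_{\mathfrak{L}}(z)=\prod_{j=1}^N\big(z_0+\sum_{i=1}^N\lambda_{ij}z_i\big)$ with $\lambda_{ij}\in\mathbb{C}$; the spectral matrix of $\mathfrak{L}$ with respect to this basis is the $N\times N$ matrix $\lambda_{\mathfrak{L}}=(\lambda_{ij})$ (its rank does not depend on the ordering of the factors). *)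

(* Defs.v *)
From HB Require Import structures.
From mathcomp Require Import all_boot all_order all_algebra.
From mathcomp Require Import complex.
From mathcomp Require Import reals.
Set Implicit Arguments. Unset Strict Implicit. Unset Printing Implicit Defensive.
Import Order.TTheory GRing.Theory Num.Theory.
Local Open Scope ring_scope.

(* A finite-dimensional Lie algebra over a field F is modelled as F^n (row
   vectors 'rV[F]_n) equipped with a bracket [br]. Subspaces are matrices
   (their row spaces, mxalgebra %MS conventions). *)

Section LieDefs.
Variables (F : fieldType) (n : nat).
Implicit Types (br : 'rV[F]_n -> 'rV[F]_n -> 'rV[F]_n).

Definition is_lie_bracket br : Prop :=
  [/\ (forall (a : F) x y z, br (a *: x + y) z = a *: br x z + br y z),
      (forall (a : F) x y z, br z (a *: x + y) = a *: br z x + br z y),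
      (forall x, br x x = 0) &
      (forall x y z, br x (br y z) + br y (br z x) + br z (br x y) = 0)].

Definition is_ideal br m (I : 'M[F]_(m, n)) : Prop :=
  forall x y : 'rV[F]_n, (y <= I)%MS -> (br x y <= I)%MS.

Definition is_simple br : Prop :=
  (exists x y, br x y != 0) /\
  forall (I : 'M[F]_n), is_ideal br I -> I = 0 \/ row_full I.

Definition is_subalgebra br m (H : 'M[F]_(m, n)) : Prop :=
  forall x y, (x <= H)%MS -> (y <= H)%MS -> (br x y <= H)%MS.

Fixpoint lbr br (k : nat) (f : nat -> 'rV[F]_n) : 'rV[F]_n :=
  match k with
  | 0 => f 0%N
  | k'.+1 => br (f 0%N) (lbr br k' (fun i => f i.+1))
  end.

(* nilpotent subalgebra: the lower central series (spanned by the iterated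
   brackets of elements of H) eventually vanishes *)
Definition is_nilpotent_sub br m (H : 'M[F]_(m, n)) : Prop :=
  exists k : nat, forall f : nat -> 'rV[F]_n,
    (forall i, (f i <= H)%MS) -> lbr br k f = 0.

Definition is_cartan br m (H : 'M[F]_(m, n)) : Prop :=
  [/\ is_subalgebra br H, is_nilpotent_sub br H &
      forall x, (forall h, (h <= H)%MS -> (br x h <= H)%MS) -> (x <= H)%MS].

(* Given the Cartan subalgebra with basis the rows of H : 'M_(r,n), a linear
   form alpha on h is represented by its values on the basis: alpha : 'rV_r
   with alpha(row i H) = alpha 0 i. *)
Definition in_rootspace br r (H : 'M[F]_(r, n)) (alpha : 'rV[F]_r)
  (x : 'rV[F]_n) : Prop :=
  forall i : 'I_r, br (row i H) x = alpha 0 i *: x.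

Definition is_root br r (H : 'M[F]_(r, n)) (alpha : 'rV[F]_r) : Prop :=
  alpha != 0 /\ exists x, x != 0 /\ in_rootspace br H alpha x.

Definition nonneg_comb r (D : 'M[F]_r) (alpha : 'rV[F]_r) : Prop :=
  exists k : 'I_r -> int, (forall i, 0 <= k i) /\
    alpha = \sum_(i < r) (row i D) *~ k i.

Definition is_base br r (H : 'M[F]_(r, n)) (D : 'M[F]_r) : Prop :=
  [/\ forall i, is_root br H (row i D),
      row_free D &
      forall alpha, is_root br H alpha ->
        nonneg_comb D alpha \/ nonneg_comb D (- alpha)].

Definition is_pos_root br r (H : 'M[F]_(r, n)) (D : 'M[F]_r)
  (alpha : 'rV[F]_r) : Prop :=
  is_root br H alpha /\ nonneg_comb D alpha.

(* Adjoint action of the i-th basis vector of a subalgebra with basis V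
   (rows of V) on that subalgebra, as a matrix in the basis V
   (row convention: row j of adB i = coordinates of [v_i, v_j]). *)
Definition adB br N (V : 'M[F]_(N, n)) (i : 'I_N) : 'M[F]_N :=
  \matrix_(j, k) (br (row i V) (row j V) *m pinvmx V) 0 k.

Definition is_spectral_matrix br N (V : 'M[F]_(N, n)) (lam : 'M[F]_N) : Prop :=
  forall (z0 : F) (z : 'rV[F]_N),
    \det (z0%:M + \sum_(i < N) z 0 i *: adB br V i)
    = \prod_(j < N) (z0 + \sum_(i < N) lam i j * z 0 i).

End LieDefs.

(* Main.v *)
Require Import Defs.
From HB Require Import structures.
From mathcomp Require Import all_boot all_order all_algebra.
From mathcomp Require Import complex.
From mathcomp Require Import reals.
From Stdlib Require Import Classical.
Import Order.TTheory GRing.Theory Num.Theory.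
Set Implicit Arguments. Unset Strict Implicit. Unset Printing Implicit Defensive.
Local Open Scope ring_scope.

(** The hypothesis that some base of simple roots is a basis of the dual of h
    replaces most of the structure theory of semisimple Lie algebras.  Roots
    vanish on [h, h], so h is abelian.  On the element h0 of h where all simple
    roots take the value 1 every root takes a nonzero integer value (its
    height), so the generalized 0-eigenspace of ad h0 is h, and
    tr((ad h0)^2) > 0, which makes the Killing form nondegenerate without
    Cartan's criterion.

    For a root b with eigenvector y, let t in h be dual to b up to sign.  One
    finds x in the generalized (-b)-part with [x, y] = t.  The trace of the
    commutator ad t vanishes on every subspace stable under ad x and ad y; a
    first such subspace gives b(t) <> 0, and a second one, the sum over j >= 1
    of the generalized (-j b)-parts orthogonal to y, must then be zero.  Hence
    the root spaces are lines, and B is a subalgebra.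

    In the basis of B made of h followed by the root vectors ordered by height,
    ad is triangular, and its diagonal gives a spectral matrix whose nonzero
    block lists the positive roots; these span the dual of h.  The rank does
    not depend on the spectral matrix, since z lambda = 0 iff the
    characteristic polynomial at z is z0^N. *)

(** * Products of operators A - c and generalized eigenvectors *)

Section Shifts.
Variables (C : numClosedFieldType) (n : nat).
Implicit Types (A B : 'M[C]_n) (u v w : 'rV[C]_n) (c : C) (cs : seq C).
Implicit Types (P : 'rV[C]_n -> Prop).

Definition shift A c u := u *m A - c *: u.

Definition shifts A cs u := foldl (fun v c => shift A c v) u cs.

Definition gweight A c u := exists m, iter m (shift A c) u = 0.

(** Subspaces are kept as predicates because they are cut out by conditions such as [gweight];
    [linear_pred_mx] yields a matrix when ranks or traces are needed. *)
Definition linear_pred P :=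
  P 0 /\ forall (a : C) u v, P u -> P v -> P (a *: u + v).

Definition stable_pred P A := forall u, P u -> P (u *m A).

Lemma shift_mulmx A c u : shift A c u = u *m (A - c%:M).
Proof. by rewrite /shift mulmxBr mul_mx_scalar. Qed.

Lemma shift0 A c : shift A c 0 = 0.
Proof. by rewrite /shift mul0mx scaler0 subrr. Qed.

Lemma shift_linear A c a u v : shift A c (a *: u + v) = a *: shift A c u + shift A c v.
Proof. by rewrite !shift_mulmx mulmxDl scalemxAl. Qed.

Lemma shiftC A c d u : shift A c (shift A d u) = shift A d (shift A c u).
Proof.
rewrite /shift !mulmxBl -!scalemxAl !scalerBr !scalerA [d * c]mulrC.
rewrite !opprB !addrA addrAC [RHS]addrAC; congr (_ + _).
by rewrite addrAC.
Qed.

Lemma shift_comm A B c u : A *m B = B *m A ->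
  shift A c (u *m B) = shift A c u *m B.
Proof. by move=> AB; rewrite /shift mulmxBl scalemxAl -!mulmxA AB. Qed.

Lemma iter_shift0 A c m : iter m (shift A c) 0 = 0.
Proof. by elim: m => //= m ->; rewrite shift0. Qed.

Lemma iter_shift_linear A c m a u v :
  iter m (shift A c) (a *: u + v) = a *: iter m (shift A c) u + iter m (shift A c) v.
Proof. by elim: m => //= m ->; rewrite shift_linear. Qed.

Lemma iter_shift_comm A B c u m : A *m B = B *m A ->
  iter m (shift A c) (u *m B) = iter m (shift A c) u *m B.
Proof. by move=> AB; elim: m => //= m ->; rewrite shift_comm. Qed.

Lemma shifts_shift A c cs u : shifts A cs (shift A c u) = shift A c (shifts A cs u).
Proof. by elim: cs u => //= d cs IH u; rewrite shiftC IH. Qed.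

Lemma shifts0 A cs : shifts A cs 0 = 0.
Proof. by elim: cs => //= c cs; rewrite shift0. Qed.

Lemma shifts_linear A cs a u v :
  shifts A cs (a *: u + v) = a *: shifts A cs u + shifts A cs v.
Proof. by elim: cs u v => //= c cs IH u v; rewrite shift_linear IH. Qed.

Lemma shifts_cat A cs ds u : shifts A (cs ++ ds) u = shifts A ds (shifts A cs u).
Proof. by rewrite /shifts foldl_cat. Qed.

Lemma shifts_nseq A c m u : shifts A (nseq m c) u = iter m (shift A c) u.
Proof. by elim: m u => //= m IH u; rewrite IH -iterSr. Qed.

Lemma shifts_catC A cs ds u : shifts A cs (shifts A ds u) = shifts A ds (shifts A cs u).
Proof. by elim: ds u => //= d ds IH u; rewrite IH shifts_shift. Qed.

Lemma gweight_linear A c : linear_pred (gweight A c).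
Proof.
split=> [|a u v [p up] [q vq]]; first by exists 0%N.
have kill i : iter (i + p) (shift A c) u = 0 by rewrite iterD up iter_shift0.
have kill' i : iter (i + q) (shift A c) v = 0 by rewrite iterD vq iter_shift0.
by exists (q + p)%N; rewrite iter_shift_linear kill addnC kill' scaler0 addr0.
Qed.

Lemma gweight_stable A B c : A *m B = B *m A -> stable_pred (gweight A c) B.
Proof. by move=> AB u [m um]; exists m; rewrite iter_shift_comm // um mul0mx. Qed.

Lemma eigen_gweight A c u : u *m A = c *: u -> gweight A c u.
Proof. by move=> uA; exists 1%N; rewrite /= /shift uA subrr. Qed.

Lemma shifts_eigen A a cs u : u *m A = a *: u ->
  shifts A cs u = (\prod_(c <- cs) (a - c)) *: u.
Proof.
move=> uA; elim: cs u uA => [|c cs IH] u uA; first by rewrite big_nil scale1r.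
rewrite /= IH /shift uA -scalerBl; first by rewrite scalerA big_cons mulrC.
by rewrite -scalemxAl uA !scalerA mulrC.
Qed.

Lemma shifts_eigen_mem A a cs u : u != 0 -> u *m A = a *: u ->
  shifts A cs u = 0 -> a \in cs.
Proof.
move=> u0 /shifts_eigen ->; move/eqP; rewrite scaler_eq0 (negPf u0) orbF.
elim: cs => [|c cs IH]; first by rewrite big_nil oner_eq0.
by rewrite big_cons mulf_eq0 subr_eq0 inE => /orP[->|/IH->]; rewrite ?orbT.
Qed.

End Shifts.

(** Cayley-Hamilton: in positive dimension the list consists of the roots of the characteristic
    polynomial with multiplicity. *)
Lemma shifts_annihilate (C : numClosedFieldType) n (A : 'M[C]_n) :
  exists cs, forall u, shifts A cs u = 0.
Proof.
case: n A => [|n] A; first by exists [::] => u; rewrite /= [u]thinmx0.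
have [cs] := closed_field_poly_normal (char_poly A).
rewrite (monicP (char_poly_monic A)) scale1r => defp.
exists cs => u; suff -> : shifts A cs u = u *m horner_mx A (char_poly A).
  by rewrite Cayley_Hamilton mulmx0.
rewrite defp; elim: cs {defp} u => [|c cs IH] u.
  by rewrite big_nil rmorph1 mulmx1.
rewrite big_cons rmorphM /= IH shift_mulmx -[_ * _]/(_ *m _) mulmxA.
by rewrite rmorphB /= horner_mx_X horner_mx_C.
Qed.

(** * Eigenvectors inside invariant subspaces *)

Section LinearPredicates.
Variables (C : numClosedFieldType) (n : nat).
Implicit Types (A B : 'M[C]_n) (u v w : 'rV[C]_n) (c : C) (cs : seq C).
Implicit Types (P : 'rV[C]_n -> Prop).

(** Apply the factors one at a time: the iterate just before the first entry into [Z] is an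
    eigenvector modulo [Z]. *)
Lemma shifts_eigen_mod A (Z : 'M[C]_n) P cs u : linear_pred P -> stable_pred P A ->
    P u -> ~~ (u <= Z)%MS -> (shifts A cs u <= Z)%MS ->
  exists c v, [/\ c \in cs, P v, ~~ (v <= Z)%MS & (shift A c v <= Z)%MS].
Proof.
move=> [P0 linP] PA; elim: cs u => [|c cs IH] u Pu uZ /= sZ; first by rewrite sZ in uZ.
have [cZ|cZ] := boolP (shift A c u <= Z)%MS.
  by exists c, u; rewrite mem_head.
have Pc : P (shift A c u).
  by rewrite /shift addrC -scaleNr; apply: linP => //; apply: PA.
have [d [v [dcs Pv vZ dZ]]] := IH _ Pc cZ sZ.
by exists d, v; rewrite inE dcs orbT.
Qed.

(* If phi is an eigenvector of the transpose of A, applying to u the factors of the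
   characteristic polynomial of A other than X - c preserves phi u <> 0. *)
Lemma shifts_functional A (phi : 'rV[C]_n -> C) c P u :
    (forall a u v, phi (a *: u + v) = a * phi u + phi v) ->
    (forall u, phi (u *m A) = c * phi u) ->
    linear_pred P -> stable_pred P A -> P u -> phi u != 0 ->
  exists v, [/\ P v, gweight A c v & phi v != 0].
Proof.
move=> linphi phiA [P0 linP] PA Pu phiu.
have [cs /(_ u) csA] := shifts_annihilate A.
have {csA} : exists m, iter m (shift A c) (shifts A cs u) = 0 by exists 0%N.
elim: cs u Pu phiu => [|d cs IH] u Pu phiu [m]; first by exists u; split=> //; exists m.
have [->|dc] := eqVneq d c.
  rewrite /= shifts_shift -iterSr => csA.
  by apply: IH Pu phiu _; exists m.+1.
move=> csA; apply: (IH (shift A d u)); last by exists m.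
  by rewrite /shift addrC -scaleNr; apply: linP => //; apply: PA.
rewrite /shift addrC -scaleNr linphi phiA -mulrDl mulf_neq0 //.
by rewrite addrC subr_eq0 eq_sym.
Qed.

(** Each application of A - d multiplies the value of [phi] by c - d, which is nonzero, while some
    power of A - d kills [u]. *)
Lemma gweight_functional A (phi : 'rV[C]_n -> C) c d u :
    (forall a u v, phi (a *: u + v) = a * phi u + phi v) ->
    (forall u, phi (u *m A) = c * phi u) -> gweight A d u -> c != d -> phi u = 0.
Proof.
move=> linphi phiA [m um] cd.
have phi0 : phi 0 = 0.
  by have := linphi (-1) 0 0; rewrite scaler0 addr0 mulN1r addNr.
have : phi (iter m (shift A d) u) = 0 by rewrite um.
have -> : phi (iter m (shift A d) u) = (c - d) ^+ m * phi u.
  elim: m {um} => [|m IH]; first by rewrite mul1r.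
  by rewrite iterS /shift addrC -scaleNr linphi phiA -mulrDl IH mulrA exprS [- d + c]addrC.
by move/eqP; rewrite mulf_eq0 expf_eq0 subr_eq0 (negPf cd) andbF => /eqP.
Qed.

Lemma gweight_eigen A c d u : u != 0 -> u *m A = c *: u -> gweight A d u -> c = d.
Proof.
move=> u0 uA [m]; rewrite -shifts_nseq => /(shifts_eigen_mem u0 uA).
by rewrite mem_nseq => /andP[_ /eqP].
Qed.

(** Vectors of [P] outside the current [W] are adjoined as long as there are any; [k] bounds the
    codimension of [W], so this stops. *)
Lemma linear_pred_mx P : linear_pred P ->
  exists W : 'M[C]_n, forall u, P u <-> (u <= W)%MS.
Proof.
case=> P0 linP.
suff ext k (W : 'M[C]_n) : (forall u, (u <= W)%MS -> P u) -> (n - \rank W <= k)%N ->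
    exists W' : 'M[C]_n, forall u, P u <-> (u <= W')%MS.
  by apply: (ext n 0); [move=> u; rewrite submx0 => /eqP-> | rewrite leq_subr].
elim: k W => [|k IH] W subW rkW.
  exists W => u; split; last exact: subW.
  move=> _; apply: submx_full; rewrite /row_full eqn_leq rank_leq_col /=.
  by rewrite -subn_eq0 -leqn0.
case: (classic (forall u, P u -> (u <= W)%MS)) => [all|].
  by exists W => u; split; [apply: all | apply: subW].
move=> nall; have [u nPu] := not_all_ex_not _ _ nall.
have [Pu /negP uW] := imply_to_and _ _ nPu.
have subW' v : (v <= W + <<u>>)%MS -> P v.
  move=> /sub_addsmxP[[a b] /= ->].
  have [c ->] : exists c, b *m <<u>>%MS = c *: u.
    by apply/sub_rVP; rewrite (submx_trans (submxMl _ _)) // genmxE.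
  by rewrite addrC; apply: linP Pu _; apply: subW; apply: submxMl.
apply: (IH (W + <<u>>)%MS subW').
have : (\rank W < \rank (W + <<u>>)%MS)%N.
  apply: rank_ltmx; rewrite /ltmx addsmxSl /=; apply: contra uW => le.
  by apply: submx_trans le; apply: submx_trans (addsmxSr _ _); rewrite genmxE.
move=> lt; rewrite -ltnS (leq_trans _ rkW) // ltn_sub2l //.
by apply: leq_trans lt (rank_leq_col _).
Qed.

Lemma stable_pred_mx P (W : 'M[C]_n) A : (forall u, P u <-> (u <= W)%MS) -> stable_pred P A ->
  stablemx W A.
Proof.
move=> PW PA; apply/row_subP => i; rewrite row_mul; apply/PW/PA/PW.
exact: row_sub.
Qed.

(** The restrictions of the [As i] to the subspace commute, hence share an eigenvector over an
    algebraically closed field. *)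
Lemma common_weight r (As : 'I_r -> 'M[C]_n) P u :
    (forall i j, As i *m As j = As j *m As i) -> linear_pred P ->
    (forall i, stable_pred P (As i)) -> P u -> u != 0 ->
  exists v (b : 'rV[C]_r), [/\ P v, v != 0 & forall i, v *m As i = b 0 i *: v].
Proof.
move=> comm linP PA Pu u0; have [W PW] := linear_pred_mx linP.
have stW i := stable_pred_mx PW (PA i).
have rW : (0 < \rank W)%N.
  rewrite lt0n mxrank_eq0; apply: contra u0 => /eqP W0.
  by move/PW: Pu; rewrite W0 submx0.
have [|v v0 /allP vA] := @spectral.common_eigenvector C _
    [seq conjmx (row_base W) (As i) | i : 'I_r] rW.
  move=> _ _ /mapP[i _ ->] /mapP[j _ ->].
  by rewrite /comm_mx -!conjmxM ?inE ?stablemx_row_base ?stW // comm.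
have nz : v *m row_base W != 0 by rewrite mulmx_free_eq0 ?row_base_free.
have ev i : exists c, v *m row_base W *m As i == c *: (v *m row_base W).
  have /vA : conjmx (row_base W) (As i) \in [seq conjmx (row_base W) (As i) | i : 'I_r].
    by apply/mapP; exists i; rewrite ?mem_enum.
  rewrite /= -[in stablemx _ _]/(conjmx (row_base W) (As i)) => st.
  have := st; rewrite (stablemx_restrict _ (stW i)) => /sub_rVP[c ->].
  by exists c.
exists (v *m row_base W), (\row_i xchoose (ev i)); split=> // [|i].
  by apply/PW; rewrite mulmx_sub // eq_row_base.
by rewrite mxE; apply/eqP/(xchooseP (ev i)).
Qed.

End LinearPredicates.

(** * Trace arguments *)

(** The trace is the sum of the roots of the characteristic polynomial, and nonnegative terms with
    sum 0 all vanish. *)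
Lemma trace0_eigenvalue (C : numClosedFieldType) m (A : 'M[C]_m) a :
  (forall b, eigenvalue A b -> 0 <= b) -> \tr A = 0 -> eigenvalue A a -> a = 0.
Proof.
move=> posA trA; rewrite eigenvalue_root_char.
have [cs] := closed_field_poly_normal (char_poly A).
rewrite (monicP (char_poly_monic A)) scale1r => defp.
have szp := size_char_poly A.
rewrite defp size_prod_XsubC in szp; case: szp => szcs.
rewrite defp root_prod_XsubC => acs.
have m0 : (0 < m)%N by rewrite -szcs; case: (cs) acs.
have := char_poly_trace A m0; rewrite defp -{1}szcs coefPn_prod_XsubC; last by rewrite szcs -lt0n.
rewrite trA oppr0 => /eqP; rewrite oppr_eq0 big_seq psumr_eq0; last first.
  by move=> i ics; apply: posA; rewrite eigenvalue_root_char defp root_prod_XsubC.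
by move/allP/(_ _ acs); rewrite acs => /eqP.
Qed.

(** On a nonzero [P] the restriction of [T] would be a commutator, of trace 0, with all eigenvalues
    positive multiples of [a]. *)
Lemma commutator_pred0 (C : numClosedFieldType) n (X Y T : 'M[C]_n) (a : C)
    (P : 'rV[C]_n -> Prop) u :
    linear_pred P -> stable_pred P X -> stable_pred P Y -> T = X *m Y - Y *m X ->
    (forall v, P v -> exists2 cs, all (fun c => 0 < c / a) cs & shifts T cs v = 0) ->
  P u -> u = 0.
Proof.
move=> linP PX PY defT posT Pu; have [W PW] := linear_pred_mx linP.
have stX := stable_pred_mx PW PX; have stY := stable_pred_mx PW PY.
apply/eqP; apply/negPn/negP => u0.
have rW : (0 < \rank W)%N.
  rewrite lt0n mxrank_eq0; apply: contra u0 => /eqP W0.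
  by move/PW: Pu; rewrite W0 submx0.
have [V [freeV VP restr]] : exists V : 'M_(\rank W, n), [/\ row_free V,
    forall w, P (w *m V) & forall A, stablemx W A -> exists A', A' *m V = V *m A].
  exists (row_base W); split=> [|w|A st]; first exact: row_base_free.
    by apply/PW; rewrite mulmx_sub // eq_row_base.
  by exists (conjmx (row_base W) A); rewrite /conjmx mulmxKpV // stablemx_row_base.
have [X' XV] := restr _ stX; have [Y' YV] := restr _ stY.
pose T' := X' *m Y' - Y' *m X'.
have TV : T' *m V = V *m T.
  rewrite /T' mulmxBl -[X' *m Y' *m V]mulmxA -[Y' *m X' *m V]mulmxA YV XV !mulmxA XV YV.
  by rewrite defT mulmxBr !mulmxA.
have evT b : eigenvalue (a^-1 *: T') b -> 0 < b.
  case/eigenvalueP=> w wT w0.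
  (* Division by zero gives zero, so for [a] = 0 the list must be empty, and then the vector itself
     is 0. *)
  have a0 : a != 0.
    apply: contraTneq w0 => a0; have [[|c cs] //=] := posT _ (VP w).
      by move=> _ /eqP; rewrite mulmx_free_eq0 // => ->.
    by rewrite a0 invr0 mulr0 ltxx.
  have wVT : w *m V *m T = (a * b) *: (w *m V).
    rewrite -mulmxA -TV mulmxA scalemxAl; congr (_ *m _).
    by rewrite -scalerA -wT -scalemxAr scalerA mulfV // scale1r.
  have [cs /allP cs0 kill] := posT _ (VP w).
  have /cs0 : a * b \in cs.
    by apply: shifts_eigen_mem wVT kill; rewrite mulmx_free_eq0.
  by rewrite mulrC mulKf.
have [b bT] := spectral.eigenvalue_closed (a^-1 *: T') rW.
have := evT _ bT; rewrite (trace0_eigenvalue _ _ bT) ?ltxx // => [b' /evT /ltW //|].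
by rewrite mxtraceZ /T' mxtraceD raddfN /= mxtrace_mulC subrr mulr0.
Qed.
(** The sum of the infinitely many subspaces [Q j]; the inductive form avoids bounding the indices
    that occur. *)
Inductive span_of (C : numClosedFieldType) n (Q : nat -> 'rV[C]_n -> Prop) :
    'rV[C]_n -> Prop :=
  | Span0 : span_of Q 0
  | SpanD j u v of Q j u & span_of Q v : span_of Q (u + v).

Lemma span_of_linear (C : numClosedFieldType) n (Q : nat -> 'rV[C]_n -> Prop) :
  (forall j, linear_pred (Q j)) -> linear_pred (span_of Q).
Proof.
move=> linQ; split=> [|a u v Su Sv]; first exact: Span0.
elim: Su => [|j {}u w Qu _ IH]; first by rewrite scaler0 add0r.
rewrite scalerDr -addrA; apply: SpanD IH.
by rewrite -[_ *: _]addr0; apply: (linQ j).2 => //; apply: (linQ j).1.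
Qed.

Lemma span_of_stable (C : numClosedFieldType) n (Q : nat -> 'rV[C]_n -> Prop) A :
    (forall j, linear_pred (Q j)) -> (forall j u, Q j u -> span_of Q (u *m A)) ->
  stable_pred (span_of Q) A.
Proof.
move=> linQ QA u; elim=> [|j {}u w Qu _ IH]; first by rewrite mul0mx; apply: Span0.
by rewrite mulmxDl -[u *m A]scale1r; apply: (span_of_linear linQ).2 => //; apply: QA Qu.
Qed.

(** * The adjoint representation and the Killing form *)

Section LieBracket.
Variables (C : numClosedFieldType) (n : nat) (br : 'rV[C]_n -> 'rV[C]_n -> 'rV[C]_n).
Hypothesis lieP : is_lie_bracket br.

Lemma br_linl a x y z : br (a *: x + y) z = a *: br x z + br y z.
Proof. by case: lieP. Qed.

Lemma br_linr a x y z : br z (a *: x + y) = a *: br z x + br z y.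
Proof. by case: lieP. Qed.

Lemma brxx x : br x x = 0.
Proof. by case: lieP. Qed.

Lemma br0l z : br 0 z = 0.
Proof. by have := br_linl (-1) 0 0 z; rewrite scaler0 addr0 scaleN1r addNr. Qed.

Lemma br0r z : br z 0 = 0.
Proof. by have := br_linr (-1) 0 0 z; rewrite scaler0 addr0 scaleN1r addNr. Qed.

Lemma brDl x y z : br (x + y) z = br x z + br y z.
Proof. by have := br_linl 1 x y z; rewrite !scale1r. Qed.

Lemma brDr x y z : br z (x + y) = br z x + br z y.
Proof. by have := br_linr 1 x y z; rewrite !scale1r. Qed.

Lemma brZl a x z : br (a *: x) z = a *: br x z.
Proof. by rewrite -[a *: x]addr0 br_linl br0l addr0. Qed.

Lemma brZr a x z : br z (a *: x) = a *: br z x.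
Proof. by rewrite -[a *: x]addr0 br_linr br0r addr0. Qed.

Lemma brC x y : br y x = - br x y.
Proof.
apply/eqP; rewrite -addr_eq0; apply/eqP; rewrite addrC.
by have := brxx (x + y); rewrite brDl !brDr !brxx add0r addr0.
Qed.

Lemma br_derivation x y z : br x (br y z) = br (br x y) z + br y (br x z).
Proof.
case: lieP => _ _ _ /(_ x y z) /eqP.
rewrite (brC (br x y) z) (brC x z) -scaleN1r brZr scaleN1r.
by rewrite subr_eq0 subr_eq addrC => /eqP.
Qed.

Lemma br_suml I (s : seq I) (f : I -> 'rV[C]_n) z :
  br (\sum_(i <- s) f i) z = \sum_(i <- s) br (f i) z.
Proof.
by elim: s => [|i s IH]; rewrite ?big_nil ?br0l // !big_cons brDl IH.
Qed.

Lemma br_sumr I (s : seq I) (f : I -> 'rV[C]_n) z :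
  br z (\sum_(i <- s) f i) = \sum_(i <- s) br z (f i).
Proof.
by elim: s => [|i s IH]; rewrite ?big_nil ?br0r // !big_cons brDr IH.
Qed.

Definition ad x : 'M[C]_n := \matrix_i br x (delta_mx 0 i).

Lemma mul_ad x y : y *m ad x = br x y.
Proof.
rewrite mulmx_sum_row [in RHS](row_sum_delta y) br_sumr.
by apply: eq_bigr => i _; rewrite rowK brZr.
Qed.

(** The factors appear in reversed order because matrices act on row vectors from the right. *)
Lemma ad_br x y : ad (br x y) = ad y *m ad x - ad x *m ad y.
Proof.
apply/row_matrixP => i; rewrite !rowE mulmxBr !mulmxA !mul_ad.
by rewrite [br x (br y _)]br_derivation addrK.
Qed.

Lemma ad_lin a x y : ad (a *: x + y) = a *: ad x + ad y.
Proof.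
apply/row_matrixP => i; rewrite !rowE mulmxDr -scalemxAr !mul_ad.
exact: br_linl.
Qed.

Lemma ad0 : ad 0 = 0.
Proof. by apply/row_matrixP => i; rewrite !rowE mulmx0 mul_ad br0l. Qed.

Lemma ad_comm x y : br x y = 0 -> ad x *m ad y = ad y *m ad x.
Proof.
by move=> xy; apply/eqP; rewrite eq_sym -subr_eq0 -ad_br xy ad0.
Qed.

Definition killing x y := \tr (ad x *m ad y).

Lemma killingC x y : killing x y = killing y x.
Proof. exact: mxtrace_mulC. Qed.

Lemma killing_linl a u v y : killing (a *: u + v) y = a * killing u y + killing v y.
Proof. by rewrite /killing ad_lin mulmxDl -scalemxAl mxtraceD mxtraceZ. Qed.

Lemma killing0l y : killing 0 y = 0.
Proof. by rewrite /killing ad0 mul0mx mxtrace0. Qed.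

Lemma killing_invariant x y z : killing (br x y) z = killing x (br y z).
Proof.
rewrite /killing !ad_br mulmxBl mulmxBr !mxtraceD !raddfN /= !mulmxA.
by rewrite -[ad y *m _ *m _]mulmxA mxtrace_mulC.
Qed.

Lemma killing_br h x y : killing (br h x) y = - killing x (br h y).
Proof.
by rewrite brC -killing_invariant -scaleN1r -[_ *: _]addr0 killing_linl killing0l addr0 mulN1r.
Qed.

(** By the Leibniz rule, ad h - (a + b) acts on a bracket through ad h - a on the left factor plus
    ad h - b on the right one; after p + q steps every term has a factor that vanishes. *)
Lemma gweight_br h a b u w :
  gweight (ad h) a u -> gweight (ad h) b w -> gweight (ad h) (a + b) (br u w).
Proof.
have step v z : shift (ad h) (a + b) (br v z) =
    br (shift (ad h) a v) z + br v (shift (ad h) b z).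
  rewrite /shift !mul_ad br_derivation ![_ - _ *: _]addrC -!scaleNr.
  by rewrite br_linl br_linr opprD scalerDl addrACA.
suff kill k p q v z : (p + q <= k)%N -> iter p (shift (ad h) a) v = 0 ->
    iter q (shift (ad h) b) z = 0 -> iter k (shift (ad h) (a + b)) (br v z) = 0.
  by move=> [p up] [q wq]; exists (p + q)%N; apply: kill up wq.
elim: k p q v z => [|k IH] [|p] [|q] v z // lek.
all: try by move=> /= -> _; rewrite br0l ?shift0 ?iter_shift0 ?shift0.
all: try by move=> _ /= ->; rewrite br0r ?shift0 ?iter_shift0 ?shift0.
move=> vp zq; rewrite iterSr step -[br (shift _ _ _) _]scale1r iter_shift_linear.
rewrite (IH p q.+1) ?(IH p.+1 q) ?scaler0 ?addr0 -?iterSr //.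
by rewrite addSnnS.
Qed.

(** * The Cartan subalgebra, its weights and heights of roots *)

Section Cartan.
Variables (r : nat) (H : 'M[C]_(r, n)) (D : 'M[C]_r).
Hypotheses (simpleP : is_simple br) (freeH : row_free H) (cartanP : is_cartan br H).
Hypothesis baseP : is_base br H D.

Local Notation rootsp := (in_rootspace br H).
Local Notation root := (is_root br H).

(* The value of the weight b at the element c *m H of h. *)
Definition evalw (c b : 'rV[C]_r) := \sum_i c 0 i * b 0 i.

Lemma evalw0 c : evalw c 0 = 0.
Proof. by rewrite /evalw big1 // => i _; rewrite mxE mulr0. Qed.

Lemma evalwD c a b : evalw c (a + b) = evalw c a + evalw c b.
Proof. by rewrite -big_split; apply: eq_bigr => i _; rewrite mxE mulrDr. Qed.

Lemma evalwN c b : evalw c (- b) = - evalw c b.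
Proof. by rewrite /evalw -sumrN; apply: eq_bigr => i _; rewrite mxE mulrN. Qed.

Lemma evalw_row c i : evalw c (row i D) = (c *m D^T) 0 i.
Proof. by rewrite mxE; apply: eq_bigr => j _; rewrite !mxE. Qed.

Lemma rootsp_br b x c : rootsp b x -> br (c *m H) x = evalw c b *: x.
Proof.
move=> bx; rewrite mulmx_sum_row br_suml scaler_suml; apply: eq_bigr => i _.
by rewrite brZl bx scalerA.
Qed.

Lemma base_unit : D \in unitmx.
Proof. by case: baseP => _; rewrite row_free_unit. Qed.

Lemma evalw_base_eq0 c : (forall i, evalw c (row i D) = 0) -> c = 0.
Proof.
move=> c0; apply: (can_inj (mulmxK (_ : D^T \in unitmx))).
  by rewrite unitmx_tr base_unit.
by apply/rowP => i; rewrite -evalw_row c0 mul0mx mxE.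
Qed.

(** Elements of h act on a root vector by scalars, so [h, h] acts by 0; thus the simple roots vanish
    on [h, h], and they span the dual of h. *)
Lemma cartan_abelian h k : (h <= H)%MS -> (k <= H)%MS -> br h k = 0.
Proof.
move=> hH kH; case: cartanP => /(_ _ _ hH kH) /submxP[c defc] _ _.
suff c0 : c = 0 by rewrite defc c0 mul0mx.
apply: evalw_base_eq0 => i; case: baseP => /(_ i) [_ [v [v0 vi]]] _ _.
have /eqP : evalw c (row i D) *: v = 0.
  have [[a defh] [b defk]] := (submxP hH, submxP kH).
  rewrite -(rootsp_br c vi) -defc defh defk.
  have := br_derivation (a *m H) (b *m H) v.
  rewrite !(rootsp_br _ vi) !brZr !(rootsp_br _ vi) !scalerA mulrC.
  by move/eqP; rewrite eq_sym -subr_eq0 addrK => /eqP.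
by rewrite scaler_eq0 (negPf v0) orbF => /eqP.
Qed.

Lemma ad_cartan_comm h k : (h <= H)%MS -> (k <= H)%MS -> ad h *m ad k = ad k *m ad h.
Proof. by move=> hH kH; rewrite ad_comm // cartan_abelian. Qed.

Lemma weight_vector P u : linear_pred P ->
    (forall h, (h <= H)%MS -> stable_pred P (ad h)) -> P u -> u != 0 ->
  exists v b, [/\ P v, v != 0 & rootsp b v].
Proof.
move=> linP PH Pu u0.
have [i j|i|v [b [Pv v0 vb]]] := @common_weight _ _ _ (fun i => ad (row i H)) P u _ linP _ Pu u0.
- by apply: ad_cartan_comm; apply: row_sub.
- by apply: PH; apply: row_sub.
by exists v, b; split=> // i; rewrite -mul_ad vb.
Qed.

(* Coordinates of the element h0 of h on which all simple roots take the value 1. *)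
Definition principal : 'rV[C]_r := const_mx 1 *m invmx D^T.
Local Notation ht := (evalw principal).
Local Notation h0 := (principal *m H).

Lemma ht_base i : ht (row i D) = 1.
Proof. by rewrite evalw_row mulmxKV ?unitmx_tr ?base_unit // mxE. Qed.

(** The height is the sum of the coefficients [k i], and nonnegative integers with sum 0 all
    vanish. *)
Lemma ht_nonneg b : nonneg_comb D b -> 0 <= ht b /\ (ht b = 0 -> b = 0).
Proof.
case=> k [k0 ->].
have -> : ht (\sum_i row i D *~ k i) = \sum_i (k i)%:~R.
  elim/big_rec2: _ => [|i x y _ <-]; first by rewrite evalw0.
  rewrite evalwD; congr (_ + _); rewrite -[k i]gez0_abs // -pmulrn -pmulrn.
  elim: `|k i|%N => [|m IH]; first by rewrite evalw0.
  by rewrite !mulrS evalwD IH ht_base.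
split=> [|/eqP]; first by apply: sumr_ge0 => i _; rewrite ler0z.
rewrite psumr_eq0 => [/allP k00|i _]; last by rewrite ler0z.
rewrite big1 // => i _; have := k00 i (mem_index_enum i).
by rewrite intr_eq0 => /eqP ->.
Qed.

(** The order on complex numbers is partial, so realness is recorded: it makes heights comparable
    and their squares nonnegative. *)
Lemma ht_root b : root b -> ht b \is Num.real /\ ht b != 0.
Proof.
move=> rb; have b0 : b != 0 by case: rb.
case: baseP => _ _ /(_ _ rb) [] /ht_nonneg [pos z].
  by split; [apply: ger0_real | apply: contra b0 => /eqP/z->].
split; first by rewrite -realN -evalwN; apply: ger0_real.
apply: contra b0 => /eqP hb; have := z.
by rewrite evalwN hb oppr0 => /(_ erefl)/eqP; rewrite oppr_eq0.
Qed.

Lemma weight_root b v : v != 0 -> rootsp b v -> b = 0 \/ root b.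
Proof.
move=> v0 bv; have [->|b0] := eqVneq b 0; first by left.
by right; split=> //; exists v.
Qed.

(* Every ad h, h in h, has only the eigenvalue 0 on the generalized 0-eigenspace of ad h0,
   so a vector outside h could be pushed into the normalizer of h. *)
Lemma principal_gweight0 u : gweight (ad h0) 0 u -> (u <= H)%MS.
Proof.
set P := gweight (ad h0) 0; have linP : linear_pred P := gweight_linear _ _.
have PH h : (h <= H)%MS -> stable_pred P (ad h).
  by move=> hH; apply: gweight_stable; apply: ad_cartan_comm => //; apply: submxMl.
(* The c-eigenvectors of ad h in [P] include a weight vector; its weight has height 0, hence is 0,
   and so c = 0. *)
have nil h c v : (h <= H)%MS -> P v -> v != 0 -> v *m ad h = c *: v -> c = 0.
  move=> hH Pv v0 vc; pose Q v := P v /\ v *m ad h = c *: v.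
  have [||w [b [[Pw wc] w0 wb]]] := @weight_vector Q v _ _ (conj Pv vc) v0.
  - split=> [|a x y [Px xc] [Py yc]].
      by split; [apply: linP.1 | rewrite mul0mx scaler0].
    split; first exact: linP.2.
    by rewrite mulmxDl -scalemxAl xc yc scalerDr !scalerA mulrC.
  - move=> k kH x [Px xc]; split; first exact: PH.
    by rewrite -mulmxA ad_cartan_comm // mulmxA xc scalemxAl.
  have htb : ht b = 0.
    by apply: gweight_eigen w0 _ Pw; rewrite mul_ad (rootsp_br _ wb).
  case: (weight_root w0 wb) => [b0|/ht_root[_]]; last by rewrite htb eqxx.
  move/submxP: hH wc => [d ->]; rewrite mul_ad (rootsp_br _ wb) b0 evalw0 scale0r.
  by move/esym/eqP; rewrite scaler_eq0 (negPf w0) orbF => /eqP.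
move=> Pu; apply/negPn/negP => uH.
(* The basis vectors of h are treated one at a time; for k = r the vector [v] normalizes h without
   lying in it. *)
have ext k : (k <= r)%N -> exists v, [/\ P v, ~~ (v <= H)%MS &
    forall i : 'I_r, (i < k)%N -> (br (row i H) v <= H)%MS].
  elim: k => [|k IH] ltk; first by exists u; split.
  have [v [Pv vH vk]] := IH (ltnW ltk).
  pose Q v := P v /\ forall i : 'I_r, (i < k)%N -> (br (row i H) v <= H)%MS.
  pose h := row (Ordinal ltk) H; have hH : (h <= H)%MS := row_sub _ _.
  have [cs csA] := shifts_annihilate (ad h).
  have linQ : linear_pred Q.
    split=> [|a x y [Px xc] [Py yc]].
      by split=> [|i _]; [apply: linP.1 | rewrite br0r sub0mx].
    split=> [|i ik]; first exact: linP.2.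
    by rewrite br_linr addmx_sub ?scalemx_sub ?xc ?yc.
  have stQ : stable_pred Q (ad h).
    move=> x [Px xc]; split=> [|i ik]; first exact: PH.
    rewrite mul_ad br_derivation (cartan_abelian (row_sub i H) hH) br0l add0r.
    by case: cartanP => + _ _; apply; rewrite ?xc.
  have [||c [w [_ [Pw wk] wH cH]]] :=
    @shifts_eigen_mod _ _ (ad h) <<H>>%MS Q cs v linQ stQ (conj Pv vk).
  - by rewrite genmxE.
  - by rewrite csA sub0mx.
  rewrite !genmxE in wH cH; exists w; split=> // i.
  (* Since ad h kills the element [shift (ad h) c w] of h, [h, w] is a c-eigenvector of ad h; if c
     were nonzero, [h, w] = 0 would put [w] into h. *)
  have c0 : c = 0.
    apply/eqP/negPn/negP => c0; have /negP[] := c0; apply/eqP.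
    apply: (nil h c (w *m ad h)) => //; first exact: PH.
      apply: contra wH => /eqP w0; move: cH; rewrite /shift w0 sub0r -scaleNr.
      by rewrite eqmx_scale // oppr_eq0.
    apply/eqP; rewrite -subr_eq0 scalemxAl -mulmxBl -/(shift _ _ _) mul_ad.
    by rewrite cartan_abelian.
  rewrite ltnS leq_eqVlt => /orP[/eqP ik|]; last exact: wk.
  move: cH; rewrite c0 /shift scale0r subr0 mul_ad /h.
  by rewrite (_ : Ordinal ltk = i) //; apply: val_inj.
have [v [_ vH vall]] := ext r (leqnn r).
case: cartanP => _ _ norm; have /negP[] := vH; apply: norm => h /submxP[d ->].
rewrite brC eqmx_opp mulmx_sum_row br_suml summx_sub // => i _.
by rewrite brZl scalemx_sub // vall.
Qed.

(* Otherwise the radical is everything, but (ad h0)^2 has nonnegative eigenvalues,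
   one of which is 1. *)
Lemma killing_nondeg y : (forall x, killing x y = 0) -> y = 0.
Proof.
have [W PW] : exists W : 'M[C]_n, forall y, (forall x, killing x y = 0) <-> (y <= W)%MS.
  apply: linear_pred_mx; split=> [x|a u v u0 v0 x]; rewrite killingC ?killing0l //.
  by rewrite killing_linl ![killing _ x]killingC u0 v0 mulr0 addr0.
case: simpleP => [[p [q pq]]] /(_ W)[|W0|full]; first last.
- have A2 : \tr (ad h0 *m ad h0) = 0.
    by apply: (PW h0).2; apply: submx_full.
  have ev b : eigenvalue (ad h0 *m ad h0) b -> 0 <= b.
    case/eigenvalueP=> v vb v0.
    (* For s a square root of b, either v is an s-eigenvector of ad h0, or [h0, v] - s v is an
       eigenvector for -s. *)
    have [s [w [sb w0 ws]]] :
        exists (s : C) (w : 'rV[C]_n), [/\ b = s ^+ 2, w != 0 & w *m ad h0 = s *: w].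
      have [w0|w0] := eqVneq (v *m ad h0) (sqrtC b *: v).
        by exists (sqrtC b), v; rewrite sqrtCK.
      exists (- sqrtC b), (v *m ad h0 - sqrtC b *: v).
      split; rewrite ?sqrrN ?sqrtCK ?subr_eq0 //.
      rewrite mulmxBl -mulmxA vb -scalemxAl -[X in X *: v](sqrtCK b) expr2 -scalerA.
      by rewrite -scalerBr scaleNr -scalerN opprB.
    have [||z [c [zs z0 zc]]] := @weight_vector (fun v => v *m ad h0 = s *: v) w _ _ ws w0.
    - split=> [|a x z xs zs]; first by rewrite mul0mx scaler0.
      by rewrite mulmxDl -scalemxAl xs zs scalerDr !scalerA mulrC.
    - move=> k kH x xs.
      by rewrite -mulmxA ad_cartan_comm ?submxMl // mulmxA xs scalemxAl.
    have -> : b = ht c ^+ 2.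
      have /eqP : s *: z = ht c *: z by rewrite -zs mul_ad (rootsp_br _ zc).
      by rewrite -subr_eq0 -scalerBl scaler_eq0 (negPf z0) orbF subr_eq0 sb => /eqP->.
    case: (weight_root z0 zc) => [->|/ht_root[re _]]; first by rewrite evalw0 expr0n.
    by rewrite real_exprn_even_ge0.
  (* A simple root is needed. If [r] = 0, every vector normalizes h = 0, so h is everything and
     abelian, against the nonzero bracket. *)
  have [i0 _] : exists i : 'I_r, true.
    case: (posnP r) => [r0|r0]; last by exists (Ordinal r0).
    have inH (x : 'rV_n) : (x <= H)%MS.
      case: cartanP => _ _; apply=> h /submxP[d ->].
      rewrite (_ : d = 0) ?mul0mx ?br0r ?sub0mx //.
      by apply/rowP => j; have := ltn_ord j; rewrite [X in (_ < X)%N]r0.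
    by rewrite cartan_abelian ?eqxx in pq.
  case: baseP => /(_ i0)[_ [v [v0 vi]]] _ _.
  have : eigenvalue (ad h0 *m ad h0) 1.
    apply/eigenvalueP; exists v => //.
    by rewrite mulmxA !mul_ad !(rootsp_br _ vi) ht_base !scale1r (rootsp_br _ vi) ht_base scale1r.
  by move/(trace0_eigenvalue ev A2)/eqP; rewrite oner_eq0.
- by move/PW; rewrite W0 submx0 => /eqP.
- move=> x z /PW zW; apply/PW => w.
  by rewrite -killing_invariant zW.
Qed.

(** The functional [killing^~ h] is killed by the transpose of ad h0, so if nonzero it is nonzero on
    the generalized 0-eigenspace, which is h. *)
Lemma killing_cartan_nondeg h : (h <= H)%MS ->
  (forall k, (k <= H)%MS -> killing k h = 0) -> h = 0.
Proof.
move=> hH hk; apply: killing_nondeg => x; apply/eqP/negPn/negP => xh.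
have [||||v [_ vw /eqP[]]] :=
  @shifts_functional _ _ (ad h0) (killing^~ h) 0 (fun=> True) x _ _ _ _ I xh.
- by move=> a u v; apply: killing_linl.
- move=> u; rewrite mul_ad killing_br cartan_abelian ?submxMl //.
  by rewrite killingC killing0l oppr0 mul0r.
- by [].
- by [].
by apply: hk; apply: principal_gweight0.
Qed.

(** * One-dimensionality of the root spaces *)

(** The line is found on the side of -b because the Killing form pairs the root vector [y] with the
    generalized (-b)-part. *)
Lemma opposite_rootspace b : root b ->
  exists x, [/\ x != 0, rootsp (- b) x & forall u, rootsp (- b) u -> exists c, u = c *: x].
Proof.
move=> rb; have [_ [y [y0 yb]]] := rb; have [_ htb] := ht_root rb.
(* By invariance, [phi] is an eigenvector of the transpose of every ad h, with eigenvalue -b(h). *)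
pose phi u := killing u y.
have linphi a u v : phi (a *: u + v) = a * phi u + phi v := killing_linl a u v y.
have phiH c u : phi (u *m ad (c *m H)) = - evalw c b * phi u.
  rewrite mul_ad /phi killing_br (rootsp_br _ yb) killingC -[_ *: y]addr0.
  by rewrite killing_linl killing0l addr0 killingC mulNr.
have commH c d : ad (c *m H) *m ad (d *m H) = ad (d *m H) *m ad (c *m H).
  by apply: ad_cartan_comm; apply: submxMl.
have yw c : gweight (ad (c *m H)) (evalw c b) y.
  by apply: eigen_gweight; rewrite mul_ad (rootsp_br _ yb).
have [x0 x0y] : exists x, phi x != 0.
  apply: NNPP => none; move/eqP: y0; apply; apply: killing_nondeg => x.
  by apply/eqP/negPn/negP => xy; apply: none; exists x.
have [||x1 [_ x1w x1y]] := @shifts_functional _ _ (ad h0) phi (- ht b) (fun=> True) x0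
    linphi (phiH _) _ _ I x0y; [by [] | by [] |].
have brH u : gweight (ad h0) (- ht b) u -> (br u y <= H)%MS.
  by move=> uw; apply: principal_gweight0; rewrite -(addNr (ht b)); apply: gweight_br.
have kbr c u : killing (c *m H) (br u y) = - evalw c b * phi u.
  by rewrite -killing_invariant -mul_ad; apply: phiH.
(* The scaling makes [t] represent -b on h through the Killing form. *)
pose t := (phi x1)^-1 *: br x1 y.
have tH : (t <= H)%MS by rewrite scalemx_sub // brH.
have kt c : killing (c *m H) t = - evalw c b.
  rewrite killingC /t -[_ *: _]addr0 killing_linl killing0l addr0 killingC kbr.
  by rewrite mulrCA mulVf // mulr1.
(* Both sides lie in h and pair equally with h, where the Killing form is nondegenerate. *)
have bry u : gweight (ad h0) (- ht b) u -> br u y = phi u *: t.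
  move=> uw; apply/eqP; rewrite -subr_eq0; apply/eqP.
  apply: killing_cartan_nondeg => [|_ /submxP[c ->]].
    by rewrite addmx_sub ?eqmx_opp ?scalemx_sub ?brH.
  rewrite killingC addrC -scaleNr killing_linl ![killing _ (c *m H)]killingC kt kbr.
  by rewrite mulNr mulrN opprK mulNr mulrC addrN.
have [d deft] := submxP tH; pose a := evalw d b.
have linw := gweight_linear (ad h0) (- ht b).
have stw c : stable_pred (gweight (ad h0) (- ht b)) (ad (c *m H)).
  by apply: gweight_stable; apply: commH.
(* Generalized (-b)-weights are only tested on h0 and [t]; the condition on [t] can be added because
   [phi] has eigenvalue -a under ad t. *)
have [x2 [x2w x2t x2y]] := @shifts_functional _ _ (ad (d *m H)) phi (- a) _ x1
    linphi (phiH d) linw (stw d) x1w x1y.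
rewrite -deft in x2t.
pose x := (phi x2)^-1 *: x2.
have phix : phi x = 1.
  by rewrite /x -[_ *: _]addr0 linphi /phi killing0l addr0 mulVf.
have xw : gweight (ad h0) (- ht b) x.
  by rewrite /x -[_ *: _]addr0; apply: linw.2 => //; apply: linw.1.
have lint := gweight_linear (ad t) (- a).
have xt : gweight (ad t) (- a) x.
  by rewrite /x -[_ *: _]addr0; apply: lint.2 => //; apply: lint.1.
have xy : br x y = t by rewrite bry // phix scale1r.
have adt : ad t = ad y *m ad x - ad x *m ad y by rewrite -xy ad_br.
have yt : gweight (ad t) a y by rewrite deft; apply: yw.
(* If a = b(t) = 0, ad x and ad y preserve each generalized eigenspace of ad t. As [t] is nonzero,
   some simple root has a nonzero value [e] at [t], and the trace argument on the e-part kills its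
   root vector. *)
have a0 : a != 0.
  apply/eqP => a0.
  have [i0 di0] : exists i, evalw d (row i D) != 0.
    apply: NNPP => none; have d0 : d = 0.
      apply: evalw_base_eq0 => i; apply/eqP/negPn/negP => di.
      by apply: none; exists i.
    move: (kt principal); rewrite deft d0 mul0mx killingC killing0l => /eqP.
    by rewrite eq_sym oppr_eq0 (negPf htb).
  case: baseP => /(_ i0)[_ [v [v0 vi]]] _ _; set e := evalw d (row i0 D) in di0.
  have vt : gweight (ad t) e v.
    by apply: eigen_gweight; rewrite mul_ad deft (rootsp_br _ vi).
  move/eqP: v0; apply; apply: (commutator_pred0 (a := e)
    (gweight_linear _ _) _ _ adt _ vt) => [u uw|u uw|u [m um]].
  - by rewrite mul_ad -[e]add0r -a0; apply: gweight_br.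
  - by rewrite mul_ad -[e]add0r -oppr0 -a0; apply: gweight_br.
  - exists (nseq m e); last by rewrite shifts_nseq.
    by rewrite all_nseq divff // ltr01 orbT.
(* The index [j] stands for the weight -(j + 1) b, so that 0 is never among the weights. *)
pose Q j u := [/\ gweight (ad h0) (- (j.+1%:R * ht b)) u,
  gweight (ad t) (- (j.+1%:R * a)) u & phi u = 0].
have linQ j : linear_pred (Q j).
  split=> [|c u v [u1 u2 u3] [v1 v2 v3]].
    by split; rewrite ?/phi ?killing0l //; apply: (gweight_linear _ _).1.
  split; rewrite ?linphi ?u3 ?v3 ?mulr0 ?addr0 //; exact: (gweight_linear _ _).2.
have succw (c : C) j : - (j.+2%:R * c) = - c + - (j.+1%:R * c).
  by rewrite -opprD -[j.+2]add1n natrD mulrDl mul1r.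
have Qx j u : Q j u -> Q j.+1 (br x u).
  case=> u1 u2 u3; split; rewrite ?succw; try exact: gweight_br.
  (* The value is -killing u t, which is 0 because [u] has a nonzero generalized weight under ad
     t. *)
  rewrite /phi killing_br xy; apply/eqP; rewrite oppr_eq0; apply/eqP.
  apply: (@gweight_functional _ _ (ad t) (killing^~ t) 0 _ u _ _ u2).
  - by move=> c v w; apply: killing_linl.
  - by move=> v; rewrite mul_ad killing_br brxx // killingC killing0l oppr0 mul0r.
  - by rewrite eq_sym oppr_eq0 mulf_neq0 // pnatr_eq0.
(* From [Q 0] nothing leaks into weight 0: [y, u] = - phi(u) t = 0. This is where orthogonality to
   [y] enters. *)
have Qy j u : Q j u -> span_of Q (br y u).
  case: j => [|j] [u1 u2 u3].
    rewrite brC bry ?u3 ?scale0r ?oppr0; first exact: Span0.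
    by rewrite mul1r in u1.
  rewrite -[br y u]addr0; apply: (@SpanD _ _ _ j); last exact: Span0.
  split.
  - by rewrite -[- _](addKr (- ht b)) opprK -succw; apply: gweight_br.
  - by rewrite -[- _](addKr (- a)) opprK -succw; apply: gweight_br.
  - by rewrite /phi killing_br brxx // killingC killing0l oppr0.
(* On the span of all [Q j], the commutator ad t divided by -a has only positive integers j + 1 as
   eigenvalues. *)
have Q0 u : Q 0%N u -> u = 0.
  move=> Qu; have Su : span_of Q u.
    by rewrite -[u]addr0; apply: SpanD Qu _; apply: Span0.
  apply: (commutator_pred0 (a := - a) (span_of_linear linQ) _ _ adt _ Su).
  - by apply: span_of_stable => // j v /Qy; rewrite mul_ad.
  - apply: span_of_stable => // j v /Qx Qv; rewrite mul_ad -[br x v]addr0.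
    by apply: SpanD Qv _; apply: Span0.
  move=> v; elim=> [|j z w [_ [m zm] _] _ [cs csp csw]]; first by exists [::].
  exists (nseq m (- (j.+1%:R * a)) ++ cs).
    rewrite all_cat csp andbT all_nseq invrN mulrNN mulfK // ltr0n orbT //.
  rewrite shifts_cat -[z]scale1r shifts_linear shifts_nseq zm scaler0 add0r.
  by rewrite shifts_catC csw shifts0.
(* Subtracting phi(u) x makes [u] orthogonal to [y], hence an element of [Q 0]. *)
have line u : gweight (ad h0) (- ht b) u -> gweight (ad t) (- a) u -> u = phi u *: x.
  move=> uw ut; apply/eqP; rewrite -subr_eq0 addrC -scaleNr; apply/eqP/Q0.
  split; rewrite ?mul1r; try exact: (gweight_linear _ _).2.
  by rewrite linphi phix mulr1 addNr.
have x_neq0 : x != 0.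
  by apply/eqP => x0'; move/eqP: phix; rewrite x0' /phi killing0l eq_sym oner_eq0.
exists x; split=> // [i|u ub].
  have rowi : row i H = delta_mx 0 i *m H by rewrite rowE.
  rewrite -mul_ad [LHS]line.
  - rewrite rowi phiH phix mulr1 mxE; congr (- _ *: _).
    rewrite /evalw (bigD1 i) //= big1 => [|j ji]; first by rewrite !mxE !eqxx mul1r addr0.
    by rewrite !mxE (negPf ji) andbF mul0r.
  - by rewrite rowi; apply: stw.
  - by apply: gweight_stable xt; apply: ad_cartan_comm => //; apply: row_sub.
exists (phi u); apply: line.
  by apply: eigen_gweight; rewrite mul_ad (rootsp_br _ ub) evalwN.
by apply: eigen_gweight; rewrite mul_ad {1}deft (rootsp_br _ ub) evalwN.
Qed.

(** The preceding lemma first shows that -b is a root, then, applied to -b, that the root space of b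
    is a line. *)
Lemma rootspace_line b x u : root b -> x != 0 -> rootsp b x -> rootsp b u ->
  exists c, u = c *: x.
Proof.
move=> rb x0 bx bu; have b0 : b != 0 by case: rb.
have [z [z0 zb _]] := opposite_rootspace rb.
have rNb : root (- b) by split; [rewrite oppr_eq0 | exists z].
have [y [y0 yb line]] := opposite_rootspace rNb; rewrite opprK in line.
have [[c xc] [d ud]] := (line _ bx, line _ bu).
have c0 : c != 0 by apply: contraNneq x0 => c0; rewrite xc c0 scale0r.
by exists (d / c); rewrite xc scalerA mulfVK.
Qed.

End Cartan.
End LieBracket.

(** * Spectral matrices: rank, triangular case and change of basis *)

Section SpectralMatrices.
Variables (C : numClosedFieldType) (n : nat) (br : 'rV[C]_n -> 'rV[C]_n -> 'rV[C]_n).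

(** For the converse, setting z0 to minus an entry of z lam makes a factor of the determinant
    vanish, so z0^N = 0. *)
Lemma spectral_kernel N (V : 'M[C]_(N, n)) lam (z : 'rV[C]_N) :
    is_spectral_matrix br V lam ->
  z *m lam = 0 <->
  forall z0, \det (z0%:M + \sum_(i < N) z 0 i *: adB br V i) = z0 ^+ N.
Proof.
move=> spec; have spec' z0 : \det (z0%:M + \sum_(i < N) z 0 i *: adB br V i) =
    \prod_j (z0 + (z *m lam) 0 j).
  rewrite spec; apply: eq_bigr => j _; rewrite mxE; congr (_ + _).
  by apply: eq_bigr => i _; rewrite mulrC.
split=> [zl z0|zl].
  rewrite spec' zl; under eq_bigr do rewrite mxE addr0.
  by rewrite prodr_const card_ord.
apply/rowP => j; rewrite [RHS]mxE; have := zl (- (z *m lam) 0 j).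
rewrite spec' (bigD1 j) //= addNr mul0r => /esym/eqP.
by rewrite expf_eq0 oppr_eq0 => /andP[_ /eqP].
Qed.

(** The left kernel depends only on the determinant, not on the chosen factorization. *)
Lemma spectral_rank N (V : 'M[C]_(N, n)) lam mu :
  is_spectral_matrix br V lam -> is_spectral_matrix br V mu -> \rank lam = \rank mu.
Proof.
move=> sl sm; have sub (a b : 'M[C]_N) : is_spectral_matrix br V a ->
    is_spectral_matrix br V b -> (kermx a <= kermx b)%MS.
  move=> sa sb; apply/row_subP => i; apply/sub_kermxP.
  by apply/(spectral_kernel _ sb)/(spectral_kernel _ sa)/sub_kermxP; apply: row_sub.
have : \rank (kermx lam) = \rank (kermx mu).
  by apply/eqP; rewrite eqn_leq !mxrankS // sub.
rewrite !mxrank_ker => eqk.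
by rewrite -(subKn (rank_leq_row lam)) eqk subKn // rank_leq_row.
Qed.

Lemma triangular_spectral N (V : 'M[C]_(N, n)) :
    (forall l j k : 'I_N, (k < j)%N -> adB br V l j k = 0) ->
  is_spectral_matrix br V (\matrix_(l, j) adB br V l j j).
Proof.
move=> trig z0 z; rewrite -det_tr det_trig.
  apply: eq_bigr => j _; rewrite !mxE eqxx mulr1n summxE; congr (_ + _).
  by apply: eq_bigr => i _; rewrite !mxE mulrC.
apply/is_trig_mxP => i j ij; rewrite !mxE summxE -val_eqE /= gtn_eqF // mulr0n add0r.
by rewrite big1 // => l _; rewrite mxE trig // mulr0.
Qed.

Hypothesis lieP : is_lie_bracket br.

Lemma adB_sum N (V : 'M[C]_(N, n)) (z : 'rV[C]_N) : is_subalgebra br V ->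
  (\sum_(i < N) z 0 i *: adB br V i) *m V = V *m ad br (z *m V).
Proof.
move=> subV; apply/row_matrixP => j.
rewrite [RHS]row_mul (mul_ad lieP) [z *m V]mulmx_sum_row (br_suml lieP) mulmx_suml.
rewrite raddf_sum; apply: eq_bigr => i _ /=.
rewrite -scalemxAl !linearZ /= (brZl lieP); congr (_ *: _).
have -> : row j (adB br V i *m V) = br (row i V) (row j V) *m pinvmx V *m V.
  by rewrite row_mul; congr (_ *m _); apply/rowP => k; rewrite !mxE.
by rewrite mulmxKpV // subV ?row_sub.
Qed.

(** Coordinates z in [V] are coordinates z P in [V'], and the two matrices of the same adjoint
    operator are conjugate by [P]. *)
Lemma spectral_basis_change N (V V' : 'M[C]_(N, n)) (P : 'M[C]_N) lam :
    V = P *m V' -> P \in unitmx -> row_free V' -> is_subalgebra br V' ->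
  is_spectral_matrix br V' lam -> is_spectral_matrix br V (P *m lam).
Proof.
move=> defV unitP freeV subV' spec z0 z.
have subV : is_subalgebra br V.
  have eqV : (V :=: V')%MS by rewrite defV; apply: eqmxMfull; rewrite row_full_unit.
  by move=> x y; rewrite !eqV; apply: subV'.
pose A := \sum_(i < N) z 0 i *: adB br V i.
pose A' := \sum_(i < N) (z *m P) 0 i *: adB br V' i.
have AP : A *m P = P *m A'.
  apply: (row_free_inj freeV); rewrite /= -!mulmxA -defV.
  by rewrite /A /A' !adB_sum // -[z *m P *m V']mulmxA -defV mulmxA -defV.
have -> : \det (z0%:M + A) = \det (z0%:M + A').
  have detP : \det P != 0 by rewrite -unitfE -unitmxE.
  apply: (mulIf detP); rewrite -det_mulmx [RHS]mulrC -det_mulmx mulmxDl mulmxDr.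
  by rewrite AP scalar_mxC.
rewrite spec; apply: eq_bigr => j _; congr (_ + _).
transitivity ((z *m P *m lam) 0 j); first by rewrite mxE; apply: eq_bigr => i _; rewrite mulrC.
by rewrite -mulmxA mxE; apply: eq_bigr => i _; rewrite mulrC.
Qed.

End SpectralMatrices.

(** * The Borel subalgebra in a basis ordered by height *)

Section Borel.
Variables (C : numClosedFieldType) (n : nat) (br : 'rV[C]_n -> 'rV[C]_n -> 'rV[C]_n).
Variables (r : nat) (H : 'M[C]_(r, n)) (D : 'M[C]_r).
Hypotheses (lieP : is_lie_bracket br) (simpleP : is_simple br) (freeH : row_free H).
Hypotheses (cartanP : is_cartan br H) (baseP : is_base br H D).

Local Notation ht := (evalw (principal D)).

(** Apply ad of a basis vector of h to the relation and subtract the multiple that cancels the term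
    of [i0]; induction handles the rest. *)
Lemma weights_independent (I : eqType) (s : seq I) (w : I -> 'rV[C]_r) (v : I -> 'rV[C]_n) :
    uniq s -> {in s &, injective w} -> (forall i, i \in s -> in_rootspace br H (w i) (v i)) ->
  \sum_(i <- s) v i = 0 -> forall i, i \in s -> v i = 0.
Proof.
elim: s v => [|i0 s IH] v //= /andP[i0s us] injw wv; rewrite big_cons => sum0.
have tail i : i \in s -> v i = 0.
  move=> si; have wi : w i != w i0.
    apply: contraNneq i0s => /injw <-; rewrite ?inE ?si ?orbT ?eqxx //.
  have [j wij] : exists j, w i 0 j != w i0 0 j.
    apply/existsP; rewrite -negb_forall; apply: contra wi => /forallP eqw.
    by apply/eqP/rowP => j; apply/eqP.
  have : (w i 0 j - w i0 0 j) *: v i = 0.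
    apply: (IH (fun k => (w k 0 j - w i0 0 j) *: v k)) si => //.
    - by apply: sub_in2 injw => k ks; rewrite inE ks orbT.
    - move=> k ks l; rewrite (brZr lieP) wv ?inE ?ks ?orbT // !scalerA.
      by rewrite mulrC.
    have := congr1 (br (row j H)) sum0.
    rewrite (br0r lieP) (brDr lieP) (br_sumr lieP) wv ?mem_head // => /eqP.
    rewrite addrC addr_eq0 -scalerN => /eqP brj.
    under eq_bigr do rewrite scalerBl.
    rewrite sumrB -scaler_sumr (_ : \sum_(k <- s) v k = - v i0); last first.
      by apply/eqP; rewrite -addr_eq0 addrC sum0.
    rewrite -brj [X in _ - X]big_seq [X in X - _]big_seq; apply/eqP; rewrite subr_eq0.
    by apply/eqP; apply: eq_bigr => k ks; rewrite wv // inE ks orbT.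
  by move/eqP; rewrite scaler_eq0 subr_eq0 (negPf wij) => /eqP.
move=> i; rewrite inE => /orP[/eqP->|/tail //].
by move: sum0; rewrite big_seq big1 ?addr0.
Qed.

Variables (E : 'rV[C]_r -> 'rV[C]_n) (S : seq 'rV[C]_r).
Hypothesis EP : forall alpha, is_root br H alpha ->
  E alpha != 0 /\ in_rootspace br H alpha (E alpha).
Hypothesis uniqS : uniq S.
Hypothesis SP : forall alpha, alpha \in S <-> is_pos_root br H D alpha.
Hypothesis sortedS : sorted (fun a b => ht a <= ht b) S.

Local Notation root_ j := (nth 0 S j).

Definition root_vectors : 'M[C]_(size S, n) := \matrix_j E (root_ j).
Definition borel_basis : 'M[C]_(r + size S, n) := col_mx H root_vectors.
Definition root_matrix : 'M[C]_(r, size S) := \matrix_(i, j) (root_ j) 0 i.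

Lemma root_in (j : 'I_(size S)) : root_ j \in S.
Proof. by rewrite mem_nth. Qed.

Lemma root_is (j : 'I_(size S)) : is_root br H (root_ j).
Proof. by have /SP[] := root_in j. Qed.

Lemma ht_pos a : a \in S -> 0 < ht a.
Proof.
move=> /SP[[a0 _] /(ht_nonneg baseP)[pos z]]; rewrite lt0r pos andbT.
by apply: contra a0 => /eqP/z->.
Qed.

Lemma cartan_weight0 c : in_rootspace br H 0 (c *m H).
Proof.
move=> i; rewrite mxE scale0r (cartan_abelian lieP cartanP baseP) ?row_sub //.
exact: submxMl.
Qed.

Lemma borel_basis_free : row_free borel_basis.
Proof.
apply: inj_row_free => v; rewrite -[v]hsubmxK mul_row_col.
set a := lsubmx v; set b := rsubmx v => vB.
pose w (o : option 'I_(size S)) := if o is Some j then root_ j else 0.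
pose u (o : option 'I_(size S)) := if o is Some j then b 0 j *: E (root_ j) else a *m H.
pose s := None :: [seq Some j | j : 'I_(size S)].
have us : uniq s.
  rewrite /= map_inj_uniq ?enum_uniq ?andbT; last by move=> ? ? [].
  by apply/negP => /mapP[].
have all0 : forall o, o \in s -> u o = 0.
  apply: (@weights_independent _ s w) => //.
  - have r0 j : root_ (j : 'I_(size S)) != 0 by case: (root_is j).
    move=> [j|] [k|] _ _ //= eqjk.
    + by congr Some; apply/val_inj/eqP;
      rewrite -(nth_uniq 0 (ltn_ord j) (ltn_ord k) uniqS); apply/eqP.
    + by have := r0 j; rewrite eqjk eqxx.
    + by have := r0 k; rewrite -eqjk eqxx.
  - move=> [j|] _ /=; last exact: cartan_weight0.
    by move=> i; rewrite (brZr lieP) (EP (root_is j)).2 !scalerA mulrC.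
  rewrite big_cons big_map big_enum /= -[RHS]vB; congr (_ + _).
  by rewrite mulmx_sum_row; apply: eq_bigr => j _; rewrite rowK.
have -> : a = 0.
  apply/eqP; rewrite -(mulmx_free_eq0 _ freeH); apply/eqP.
  exact: (all0 None (mem_head _ _)).
have -> : b = 0; last by rewrite row_mx0.
apply/rowP => j; rewrite [RHS]mxE; have : u (Some j) = 0.
  by apply: all0; rewrite inE; apply/mapP; exists j; rewrite ?mem_enum.
by move/eqP; rewrite scaler_eq0 (negPf (EP (root_is j)).1) orbF => /eqP.
Qed.

(** Each bracket is a multiple of one basis vector, never before position [j]; it stays at [j] with
    a nonzero coefficient only when [l] indexes h and [j] a root vector. *)
Lemma borel_bracket (l j : 'I_(r + size S)) : exists w : 'rV[C]_(r + size S),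
  [/\ br (row l borel_basis) (row j borel_basis) = w *m borel_basis,
      forall k : 'I_(r + size S), (k < j)%N -> w 0 k = 0 &
      w 0 j = block_mx 0 root_matrix 0 0 l j].
Proof.
have deltaE (k : 'I_(r + size S)) : delta_mx 0 k *m borel_basis = row k borel_basis.
  by rewrite -rowE.
have rowl i : row (lshift _ i) borel_basis = row i H by rewrite rowKu.
have rowr i : row (rshift _ i) borel_basis = E (root_ i) by rewrite rowKd rowK.
have delta0 (k p : 'I_(r + size S)) : (k < p)%N -> (delta_mx 0 p : 'rV[C]_(r + size S)) 0 k = 0.
  by move=> lt; rewrite mxE eqxx -val_eqE /= ltn_eqF.
case: (split_ordP l) => i ->; case: (split_ordP j) => i' ->.
- exists 0; rewrite mul0mx !rowl (cartan_abelian lieP cartanP baseP) ?row_sub //.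
  by split=> // [k _|]; rewrite ?block_mxEul !mxE.
- exists (root_ i' 0 i *: delta_mx 0 (rshift r i')); split.
  + by rewrite -scalemxAl deltaE rowl !rowr (EP (root_is i')).2.
  + by move=> k lt; rewrite mxE delta0 ?mulr0.
  + by rewrite block_mxEur !mxE !eqxx mulr1.
- have lti : (i' < r + i)%N by apply: leq_trans (ltn_ord i') (leq_addr _ _).
  exists (- root_ i 0 i' *: delta_mx 0 (rshift r i)); split.
  + rewrite -scalemxAl deltaE rowl !rowr (brC lieP) (EP (root_is i)).2.
    by rewrite scaleNr.
  + by move=> k lt; rewrite mxE delta0 ?mulr0 //; apply: ltn_trans lt lti.
  + by rewrite block_mxEdl mxE delta0 ?mulr0 // mxE.
rewrite !rowr; set a := root_ i; set b := root_ i'.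
have [ab0|nz] := eqVneq (br (E a) (E b)) 0.
  exists 0; rewrite mul0mx; split=> // [k _|]; by rewrite ?block_mxEdr !mxE.
have abr : in_rootspace br H (a + b) (br (E a) (E b)).
  move=> k; rewrite (br_derivation lieP) (EP (root_is i)).2 (EP (root_is i')).2.
  by rewrite (brZl lieP) (brZr lieP) -scalerDl mxE.
have htab : ht (a + b) = ht a + ht b by apply: evalwD.
have [hta htb] := (ht_pos (root_in i), ht_pos (root_in i')).
have ab_root : is_root br H (a + b).
  split; last by exists (br (E a) (E b)).
  apply: contraTneq (addr_gt0 hta htb) => ab0.
  by rewrite -htab ab0 evalw0 ltxx.
have abS : a + b \in S.
  apply/SP; split=> //.
  have [[_ [k [k0 ka]]] [_ [k' [k'0 k'b]]]] := ((SP _).1 (root_in i), (SP _).1 (root_in i')).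
  exists (fun p => k p + k' p); split=> [p|]; first by rewrite addr_ge0.
  by rewrite /a ka /b k'b -big_split; apply: eq_bigr => p _; rewrite mulrzDr.
have [c abc] := rootspace_line lieP simpleP cartanP baseP ab_root
  (EP ab_root).1 (EP ab_root).2 abr.
pose p := index (a + b) S; have ltp : (p < size S)%N by rewrite index_mem.
(* The height of a + b exceeds that of b, so a + b comes later in the sorted list. *)
have ltb : (i' < p)%N.
  rewrite ltnNge; apply/negP => le.
  have trans : transitive (fun x y : 'rV[C]_r => ht x <= ht y).
    by move=> x y z; apply: le_trans.
  have := sorted_leq_nth trans (fun _ => lexx _) 0 sortedS p i' ltp (ltn_ord i') le.
  by rewrite nth_index // -/b htab gerDr (lt_geF (hta : 0 < ht a)).
exists (c *: delta_mx 0 (rshift r (Ordinal ltp))); split.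
- by rewrite -scalemxAl deltaE rowr /= nth_index.
- move=> k lt; rewrite mxE delta0 ?mulr0 //; apply: ltn_trans lt _.
  by rewrite /= ltn_add2l.
- by rewrite block_mxEdr mxE delta0 ?mulr0 ?mxE //= ltn_add2l.
Qed.

Lemma borel_subalgebra : is_subalgebra br borel_basis.
Proof.
move=> x y /submxP[c ->] /submxP[d ->].
rewrite !mulmx_sum_row (br_suml lieP) summx_sub // => l _.
rewrite (br_sumr lieP) summx_sub // => j _.
rewrite (brZl lieP) (brZr lieP) !scalemx_sub //.
by have [w [-> _ _]] := borel_bracket l j; apply: submxMl.
Qed.

Lemma borel_adB (l j : 'I_(r + size S)) :
  (forall k : 'I_(r + size S), (k < j)%N -> adB br borel_basis l j k = 0) /\
  adB br borel_basis l j j = block_mx 0 root_matrix 0 0 l j.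
Proof.
have [w [brw w0 wj]] := borel_bracket l j.
have adE k : adB br borel_basis l j k = w 0 k.
  by rewrite mxE brw (mulmxKp borel_basis_free).
by split=> [k /w0 wk|]; rewrite adE.
Qed.

Lemma borel_spectral : is_spectral_matrix br borel_basis (block_mx 0 root_matrix 0 0).
Proof.
have -> : block_mx 0 root_matrix 0 0 = \matrix_(l, j) adB br borel_basis l j j.
  by apply/matrixP => l j; rewrite [RHS]mxE (borel_adB l j).2.
by apply: triangular_spectral => l j k; apply: (borel_adB l j).1.
Qed.

(** The simple roots are positive, so all rows of the invertible [D] occur among the columns. *)
Lemma root_matrix_rank : \rank root_matrix = r.
Proof.
apply/eqP; rewrite eqn_leq rank_leq_row -mxrank_tr.
have rD : \rank D = r by case: baseP => _ /eqP.
rewrite -[X in (X <= _)%N]rD; apply/mxrankS/row_subP => i.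
have DS : row i D \in S.
  apply/SP; split; first by case: baseP.
  exists (fun j => (j == i)%:R); split=> [j|]; first by rewrite ler0n.
  rewrite (bigD1 i) //= eqxx big1 ?addr0 // => j /negPf ->.
  by rewrite mulr0z.
have ltp : (index (row i D) S < size S)%N by rewrite index_mem.
suff -> : row i D = row (Ordinal ltp) root_matrix^T by apply: row_sub.
by apply/rowP => j; rewrite !mxE /= nth_index // mxE.
Qed.

Lemma borel_spectral_rank : \rank (block_mx 0 root_matrix 0 0 : 'M[C]_(r + size S)) = r.
Proof. by rewrite block_mxEv row_mx0 rank_col_mx0 rank_row_0mx root_matrix_rank. Qed.

(** Any other basis differs by an invertible [P], and multiplying the spectral matrix by [P]
    preserves its rank. *)
Lemma borel_basis_spectral_rank N (V : 'M[C]_(N, n)) : row_free V -> (V :=: borel_basis)%MS ->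
  (exists lam, is_spectral_matrix br V lam) /\
  (forall lam, is_spectral_matrix br V lam -> \rank lam = r).
Proof.
move=> freeV eqV; have defN : N = (r + size S)%N.
  by rewrite -(eqP freeV) eqV (eqP borel_basis_free).
subst N; have /submxP[P defV] : (V <= borel_basis)%MS by rewrite eqV.
have unitP : P \in unitmx.
  rewrite -row_free_unit /row_free eqn_leq rank_leq_row -[X in (X <= _)%N](eqP freeV).
  by rewrite defV mxrankM_maxl.
have spec := spectral_basis_change lieP defV unitP borel_basis_free
  borel_subalgebra borel_spectral.
split; first by exists (P *m block_mx 0 root_matrix 0 0).
move=> lam /spectral_rank -/(_ _ spec) ->.
by rewrite (eqmxMfull _ (_ : row_full P)) ?row_full_unit // borel_spectral_rank.
Qed.

End Borel.

(** * Passage from the given list of positive roots to the sorted one *)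

Lemma sumsmx_seq_subP (F : fieldType) n (I : eqType) (s : seq I) (f : I -> 'rV[F]_n) m
    (W : 'M[F]_(m, n)) :
  (forall i, i \in s -> (f i <= W)%MS) <-> (\sum_(i <- s) <<f i>> <= W)%MS.
Proof.
elim: s => [|i s IH]; first by rewrite big_nil sub0mx.
rewrite big_cons addsmx_sub genmxE; split=> [fW|/andP[fi /IH fs] j].
  by rewrite fW ?mem_head //; apply/IH => j js; rewrite fW // inE js orbT.
by rewrite inE => /orP[/eqP->|/fs].
Qed.

Theorem theorem6p2 (R : realType) (n : nat)
  (br : 'rV[R[i]]_n -> 'rV[R[i]]_n -> 'rV[R[i]]_n)
  (r : nat) (H : 'M[R[i]]_(r, n)) (D : 'M[R[i]]_r)
  (E : 'rV[R[i]]_r -> 'rV[R[i]]_n) (Phip : seq 'rV[R[i]]_r)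
  (N : nat) (V : 'M[R[i]]_(N, n)) :
  is_lie_bracket br -> is_simple br ->
  row_free H -> is_cartan br H ->
  is_base br H D ->
  (forall alpha, is_root br H alpha ->
     E alpha != 0 /\ in_rootspace br H alpha (E alpha)) ->
  uniq Phip -> (forall alpha, alpha \in Phip <-> is_pos_root br H D alpha) ->
  row_free V -> (V == H + \sum_(alpha <- Phip) <<E alpha>>)%MS ->
  (exists lam : 'M[R[i]]_N, is_spectral_matrix br V lam) /\
  (forall lam : 'M[R[i]]_N, is_spectral_matrix br V lam -> \rank lam = r).
Proof.
move=> lieP simpleP freeH cartanP baseP EP uniqP PhiP freeV /eqmxP eqV.
pose le_ht (a b : 'rV[R[i]]_r) := evalw (principal D) a <= evalw (principal D) b.
pose S := sort le_ht Phip.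
have memS a : a \in S = (a \in Phip) by rewrite mem_sort.
have SP a : a \in S <-> is_pos_root br H D a by rewrite memS.
have sortedS : sorted le_ht S.
  (* The comparison is total only on roots, whose heights are real. *)
  apply: (@sort_sorted_in _ (mem Phip)); last exact/allP.
  move=> a b /PhiP[ra _] /PhiP[rb _].
  exact: real_leVge (ht_root baseP ra).1 (ht_root baseP rb).1.
have uniqS : uniq S by rewrite sort_uniq.
apply: (borel_basis_spectral_rank lieP simpleP freeH cartanP baseP EP uniqS SP sortedS freeV).
apply: eqmx_trans eqV _; apply: eqmx_trans (addsmxE _ _).
apply: adds_eqmx (eqmx_refl _) _; apply/eqmxP/andP; split.
  apply/sumsmx_seq_subP => a; rewrite -memS => aS.
  have lta : (index a S < size S)%N by rewrite index_mem.
  suff -> : E a = row (Ordinal lta) (root_vectors E S) by apply: row_sub.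
  by rewrite rowK /= nth_index.
apply/row_subP => j; rewrite rowK.
have : nth 0 S j \in Phip by rewrite -memS mem_nth.
by move: (nth 0 S j); apply/sumsmx_seq_subP.
Qed.
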